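(* Let $a,b$ be nonzero real numbers, let $\mathcal{F}_n(a,b,x)$ be the bi-periodic Fibonacci matrix polynomials, let $\mathcal{A}_{n}(a,b,x)=\sqrt{x}\,a^{\varepsilon(n)/2}b^{(1-\varepsilon(n))/2}\mathcal{F}_{n}(a,b,x)$, let $k=x\sqrt{ab}$, and for $n\in\mathbb{N}$ let $f_n(a,b,x)=\sum_{i=0}^{n}\binom{n}{i}k^{n-i}\mathcal{A}_i(a,b,x)$ and $r_n(a,b,x)=\sum_{i=0}^{n}\binom{n}{i}k^{i}\mathcal{A}_i(a,b,x)$ be the falling and rising $k$-binomial transforms of $(\mathcal{A}_n(a,b,x))$. Then for every $n\in\mathbb{N}$ the following Binet formulas hold: $$f_{n}(a,b,x)=C\left(r_{8}^{n}(x)-r_{7}^{n}(x)\right)+\frac{\sqrt{bx}\,\mathcal{F}_{0}(a,b,x)}{2}\left(r_{8}^{n}(x)+r_{7}^{n}(x)\right),$$ $$r_{n}(a,b,x)=C\left(r_{6}^{n}(x)-r_{5}^{n}(x)\right)+\frac{\sqrt{bx}\,\mathcal{F}_{0}(a,b,x)}{2}\left(r_{6}^{n}(x)+r_{5}^{n}(x)\right),$$ where $r_5(x)$ and $r_6(x)$ are roots of $r^{2}-(abx^{2}+2)r+1=0$, $r_7(x)$ and $r_8(x)$ are roots of $r^{2}-3x\sqrt{ab}\,r+2abx^{2}-1=0$, and $$C=\frac{bx\sqrt{ax}\,\mathcal{F}_{0}(a,b,x)-2\sqrt{ax}\,\mathcal{F}_{1}(a,b,x)}{2\sqrt{abx^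{2}+4}}.$$
   Context: Here $\varepsilon(n)=n-2\lfloor n/2\rfloor$ (so $\varepsilon(n)=1$ for $n$ odd and $0$ for $n$ even). The bi-periodic Fibonacci matrix polynomials are the $2\times 2$ matrices defined by $\mathcal{F}_0(a,b,x)=\begin{pmatrix}1&0\\0&1\end{pmatrix}$, $\mathcal{F}_1(a,b,x)=\begin{pmatrix}bx&\frac{b}{a}\\1&0\end{pmatrix}$ and, for $n\ge 2$, $\mathcal{F}_n(a,b,x)=ax\,\mathcal{F}_{n-1}(a,b,x)+\mathcal{F}_{n-2}(a,b,x)$ if $n$ is even, $\mathcal{F}_n(a,b,x)=bx\,\mathcal{F}_{n-1}(a,b,x)+\mathcal{F}_{n-2}(a,b,x)$ if $n$ is odd. The transforms $r_n(a,b,x)$ are matrices, not to be confused with the scalar roots $r_5(x),\dots,r_8(x)$; $r_j^n(x)$ means $(r_j(x))^n$.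
   Formalization: The roots are labelled by r5−r6 = x√(ab)√(abx²+4) and r7−r8 = √(abx²+4), since the other labelling is false; square roots are complex, with √(ab)=√a√b, √(ax)=√a√x, √(bx)=√b√x, and abx²+4 ≠ 0 is assumed. *)

(* Defs.v *)
From HB Require Import structures.
From mathcomp Require Import all_boot all_order all_algebra.
From mathcomp Require Import complex reals.

Set Implicit Arguments.
Unset Strict Implicit.
Unset Printing Implicit Defensive.

Import GRing.Theory.
Local Open Scope ring_scope.

Definition eps (n : nat) : nat := (n - 2 * (n %/ 2))%N.

Definition bifib_mx1 (K : fieldType) (a b x : K) : 'M[K]_2 :=
  \matrix_(i < 2, j < 2)
    nth 0 (nth [::] [:: [:: b * x; b / a];
                        [:: 1    ; 0    ]] i) j.

Fixpoint bifib_mx (K : fieldType) (a b x : K) (n : nat) : 'M[K]_2 :=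
  match n with
  | 0 => 1%:M
  | 1 => bifib_mx1 a b x
  | (m.+1 as p).+1 =>
      ((if odd n then b else a) * x) *: bifib_mx a b x p + bifib_mx a b x m
  end.

(* The arguments sa, sb, sx stand for chosen square roots of a, b, x, so that
   a^(eps(n)/2) is rendered as sa ^+ eps n, and similarly for b.  As a and b
   may be negative, these are in general complex.  Square roots of products
   are always the products of the chosen roots: sqrt(ab) is sa * sb, etc.
   (principal roots would give sqrt(a) sqrt(b) = - sqrt(ab) for a, b < 0). *)
Definition scaled_bifib_mx (K : fieldType) (a b x sa sb sx : K) (n : nat) :
    'M[K]_2 :=
  (sx * sa ^+ eps n * sb ^+ (1 - eps n)) *: bifib_mx a b x n.

Definition falling_binomial (K : fieldType) (V : lmodType K) (k : K)
    (A : nat -> V) (n : nat) : V :=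
  \sum_(0 <= i < n.+1) ('C(n, i)%:R * k ^+ (n - i)) *: A i.

Definition rising_binomial (K : fieldType) (V : lmodType K) (k : K)
    (A : nat -> V) (n : nat) : V :=
  \sum_(0 <= i < n.+1) ('C(n, i)%:R * k ^+ i) *: A i.

(* Main.v *)
Require Import Defs.
From HB Require Import structures.
From mathcomp Require Import all_boot all_order all_algebra.
From mathcomp Require Import complex reals.
From mathcomp Require Import ring.

(** The weights of [scaled_bifib_mx] are chosen so that the two alternating
    recurrences of the bi-periodic sequence merge into one with constant
    coefficients, A_(n+2) = k A_(n+1) + A_n with k = x sqrt(ab)
    ([scaled_bifib_mx_rec]).  Its characteristic roots are
    l, m = (k +- sd) / 2, where sd^2 = k^2 + 4, so that A_n = l^n u + m^n v
    ([binet_linear_recurrence]) with u = A_0 / 2 - C and v = A_0 / 2 + C.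

    By the binomial theorem, the binomial transforms send a geometric sequence
    of ratio l to one of ratio k + l (falling) or 1 + k l (rising).  It remains
    to recognise these ratios: k + l = r7 and k + m = r8, while
    1 + k l = l^2 = r5 and 1 + k m = m^2 = r6.  Both identifications are the
    quadratic formula, in which the prescribed difference of the two roots
    settles which one takes which sign ([quadratic_roots]). *)

Set Implicit Arguments.
Unset Strict Implicit.
Unset Printing Implicit Defensive.

Import GRing.Theory.
Local Open Scope ring_scope.
Local Open Scope complex_scope.

(** With P = 2 r - p, the two equations say that P^2 = d^2 and
    (P - 2 d)^2 = d^2, whence (P - d)^2 = 0.  This argument also covers a double
    root (d = 0), which does occur: r5 = r6 when x = 0. *)
Lemma quadratic_roots (K : fieldType) (p q d r s : K) :
    (2 : K) != 0 -> d ^+ 2 = p ^+ 2 - 4 * q ->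
    r ^+ 2 - p * r + q = 0 -> s ^+ 2 - p * s + q = 0 -> r - s = d ->
  r = (p + d) / 2 /\ s = (p - d) / 2.
Proof.
move=> two_neq0 d2 hr hs rs.
have s_def : s = r - d by rewrite -rs; ring.
have sq0 : (2 * r - p - d) ^+ 2 = 0.
  transitivity (2 * (r ^+ 2 - p * r + q) + 2 * (s ^+ 2 - p * s + q)
                - (d ^+ 2 - (p ^+ 2 - 4 * q))).
    by rewrite s_def; ring.
  by rewrite hr hs d2 subrr !mulr0 addr0 subr0.
have r_def : r = (p + d) / 2.
  have /eqP := sq0; rewrite expf_eq0 /= => /eqP h0.
  have -> : p + d = 2 * r by rewrite -[RHS]subr0 -h0; ring.
  by field.
by split=> //; rewrite s_def r_def; field.
Qed.

Lemma binet_linear_recurrence (K : fieldType) (V : lmodType K) (k l m : K)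
    (A : nat -> V) (u v : V) :
    l ^+ 2 = k * l + 1 -> m ^+ 2 = k * m + 1 ->
    (forall n, A n.+2 = k *: A n.+1 + A n) ->
    A 0%N = u + v -> A 1%N = l *: u + m *: v ->
  forall n, A n = l ^+ n *: u + m ^+ n *: v.
Proof.
move=> hl hm recA A0 A1 n.
suff [] : A n = l ^+ n *: u + m ^+ n *: v
       /\ A n.+1 = l ^+ n.+1 *: u + m ^+ n.+1 *: v by [].
elim: n => [|n [IH0 IH1]]; first by rewrite !expr0 !expr1 !scale1r.
split=> //; rewrite recA IH1 IH0 scalerDr !scalerA addrACA -!scalerDl.
have stepE t : t ^+ 2 = k * t + 1 -> t ^+ n.+2 = k * t ^+ n.+1 + t ^+ n.
  by move=> ht; rewrite -addn2 exprD ht exprS; ring.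
by rewrite -!stepE.
Qed.

Lemma falling_binomial_geometric (K : fieldType) (V : lmodType K) (k l m : K)
    (A : nat -> V) (u v : V) :
    (forall n, A n = l ^+ n *: u + m ^+ n *: v) ->
  forall n, falling_binomial k A n = (k + l) ^+ n *: u + (k + m) ^+ n *: v.
Proof.
move=> AE n; rewrite /falling_binomial big_mkord !exprDn !scaler_suml.
rewrite -big_split /=; apply: eq_bigr => i _.
by rewrite AE scalerDr !scalerA -!mulrA !mulr_natl.
Qed.

Lemma rising_binomial_geometric (K : fieldType) (V : lmodType K) (k l m : K)
    (A : nat -> V) (u v : V) :
    (forall n, A n = l ^+ n *: u + m ^+ n *: v) ->
  forall n,
    rising_binomial k A n = (1 + k * l) ^+ n *: u + (1 + k * m) ^+ n *: v.
Proof.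
move=> AE n; rewrite /rising_binomial big_mkord !exprDn !scaler_suml.
rewrite -big_split /=; apply: eq_bigr => i _.
by rewrite AE scalerDr !scalerA -!mulrA !mulr_natl !expr1n !mul1r !exprMn.
Qed.

Lemma epsE (n : nat) : eps n = odd n.
Proof. by rewrite /eps mulnC {1}(divn_eq n 2) addKn modn2. Qed.

(** Passing from index n + 1 to n + 2 trades one of sa, sb for the other, and
    the coefficient a x or b x of the recurrence contributes the square that
    pays for the exchange: sb a = (sa sb) sa and sa b = (sa sb) sb. *)
Lemma scaled_bifib_mx_rec (K : fieldType) (a b x sa sb sx : K) :
    sa ^+ 2 = a -> sb ^+ 2 = b ->
  forall n, scaled_bifib_mx a b x sa sb sx n.+2 =
    (x * (sa * sb)) *: scaled_bifib_mx a b x sa sb sx n.+1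
    + scaled_bifib_mx a b x sa sb sx n.
Proof.
move=> <- <- n; rewrite /scaled_bifib_mx !epsE.
have -> : bifib_mx (sa ^+ 2) (sb ^+ 2) x n.+2 =
    ((if odd n.+2 then sb ^+ 2 else sa ^+ 2) * x)
      *: bifib_mx (sa ^+ 2) (sb ^+ 2) x n.+1
    + bifib_mx (sa ^+ 2) (sb ^+ 2) x n by [].
rewrite /= negbK scalerDr !scalerA.
by congr (_ *: _ + _); case: (odd n) => /=; ring.
Qed.

Lemma scale_sum_diff (K : fieldType) (V : lmodType K) (r s : K) (h c : V) :
  r *: (h - c) + s *: (h + c) = (s - r) *: c + (s + r) *: h.
Proof.
rewrite scalerBr scalerDr scalerBl scalerDl addrACA addrC.
by congr (_ + _); apply: addrC.
Qed.

Theorem theorem3p9 (R : realType) (a0 b0 : R) (ha : a0 != 0) (hb : b0 != 0)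
    (x : R[i]) :
  let a : R[i] := a0%:C in
  let b : R[i] := b0%:C in
  (* any square roots of a, b, x and a b x^2 + 4 *)
  forall sa sb sx sd : R[i],
  sa ^+ 2 = a -> sb ^+ 2 = b -> sx ^+ 2 = x ->
  sd ^+ 2 = a * b * x ^+ 2 + 4 ->
  (* C is defined *)
  a * b * x ^+ 2 + 4 != 0 ->
  let sqrt_ab := sa * sb in
  let sqrt_ax := sa * sx in
  let sqrt_bx := sb * sx in
  let k := x * sqrt_ab in
  let F := bifib_mx a b x in
  let A := scaled_bifib_mx a b x sa sb sx in
  let C := (2 * sd)^-1 *:
             ((b * x * sqrt_ax) *: F 0%N - (2 * sqrt_ax) *: F 1%N) in
  forall r5 r6 r7 r8 : R[i],
  r5 ^+ 2 - (a * b * x ^+ 2 + 2) * r5 + 1 = 0 ->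
  r6 ^+ 2 - (a * b * x ^+ 2 + 2) * r6 + 1 = 0 ->
  r7 ^+ 2 - 3 * x * sqrt_ab * r7 + 2 * a * b * x ^+ 2 - 1 = 0 ->
  r8 ^+ 2 - 3 * x * sqrt_ab * r8 + 2 * a * b * x ^+ 2 - 1 = 0 ->
  (* labelling of the two roots of each equation: r5 and r7 are the roots with
     the plus sign in the quadratic formula, r6 and r8 those with minus *)
  r5 - r6 = x * sqrt_ab * sd ->
  r7 - r8 = sd ->
  forall n : nat,
    falling_binomial k A n =
      (r8 ^+ n - r7 ^+ n) *: C
      + ((r8 ^+ n + r7 ^+ n) * (sqrt_bx / 2)) *: F 0%N
    /\
    rising_binomial k A n =
      (r6 ^+ n - r5 ^+ n) *: C
      + ((r6 ^+ n + r5 ^+ n) * (sqrt_bx / 2)) *: F 0%N.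
Proof.
move=> a b sa sb sx sd hsa hsb hsx hsd disc_neq0 sqrt_ab sqrt_ax sqrt_bx k F A C.
move=> r5 r6 r7 r8 hr5 hr6 hr7 hr8 r56 r78.
have two_neq0 : (2 : R[i]) != 0 by rewrite Num.Theory.pnatr_eq0.
have sd_neq0 : sd != 0 by move: disc_neq0; rewrite -hsd expf_eq0.
have k2 : k ^+ 2 = a * b * x ^+ 2.
  by rewrite -hsa -hsb /k /sqrt_ab; ring.
have sd2 : sd ^+ 2 = k ^+ 2 + 4 by rewrite k2.
pose l := (k + sd) / 2; pose m := (k - sd) / 2.
have hl : l ^+ 2 = k * l + 1.
  transitivity ((k ^+ 2 + 2 * k * sd + sd ^+ 2) / 4); first by rewrite /l; field.
  by rewrite sd2 /l; field.
have hm : m ^+ 2 = k * m + 1.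
  transitivity ((k ^+ 2 - 2 * k * sd + sd ^+ 2) / 4); first by rewrite /m; field.
  by rewrite sd2 /m; field.
have [r7E r8E] : r7 = (3 * k + sd) / 2 /\ r8 = (3 * k - sd) / 2.
  apply: (quadratic_roots (q := 2 * k ^+ 2 - 1)) => //.
  - by rewrite sd2; ring.
  - by rewrite k2 -[RHS]hr7 /k; ring.
  - by rewrite k2 -[RHS]hr8 /k; ring.
have [r5E r6E] : r5 = (k ^+ 2 + 2 + k * sd) / 2
              /\ r6 = (k ^+ 2 + 2 - k * sd) / 2.
  apply: (quadratic_roots (q := 1)) => //; first by rewrite exprMn sd2; ring.
  - by rewrite k2.
  - by rewrite k2.
have A0 : A 0%N = sqrt_bx *: F 0%N.
  by congr (_ *: _); rewrite /sqrt_bx /= expr0 expr1; ring.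
have A1 : A 1%N = sqrt_ax *: F 1%N.
  by congr (_ *: _); rewrite /sqrt_ax /= expr0 expr1; ring.
pose h := (sqrt_bx / 2) *: F 0%N.
have AE : forall n, A n = l ^+ n *: (h - C) + m ^+ n *: (h + C).
  apply: (binet_linear_recurrence hl hm).
  - exact: scaled_bifib_mx_rec.
  - rewrite A0 addrACA addNr addr0 -scalerDl.
    by congr (_ *: _); field.
  (* h contributes (m + l) h = k A_0 / 2, which cancels the F_0 part of
     (m - l) C = - sd C *)
  - rewrite A1 scale_sum_diff /C /h !scalerBr !scalerA.
    have ml : m - l = - sd by rewrite /m /l; field.
    have lm : m + l = k by rewrite /m /l; field.
    rewrite ml lm addrAC -scalerDl -scaleNr -[LHS]add0r -(scale0r (F 0%N)).
    congr (_ *: _ + _ *: _); last by field.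
    by rewrite -hsb /k /sqrt_ab /sqrt_ax /sqrt_bx; field.
move=> n; split.
- rewrite (falling_binomial_geometric _ AE) scale_sum_diff -(scalerA _ (sqrt_bx / 2)).
  have -> : k + l = r7 by rewrite r7E /l; field.
  by have -> : k + m = r8 by rewrite r8E /m; field.
- rewrite (rising_binomial_geometric _ AE) scale_sum_diff -(scalerA _ (sqrt_bx / 2)).
  have -> : 1 + k * l = r5 by rewrite r5E /l; field.
  by have -> : 1 + k * m = r6 by rewrite r6E /m; field.
Qed.
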